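(* Fix $0\le\ell<u$ and $n\ge2$. For each $p>1$ let $\boldsymbol\xi(p)=(\ell,\xi_1(p),\ldots,\xi_{n-1}(p),u)$, $\ell<\xi_1(p)<\cdots<\xi_{n-1}(p)<u$, be the minimizer of $\operatorname{vol}(\breve{U}^*_p(\boldsymbol\xi))$ over all $\boldsymbol\xi=(\ell,\xi_1,\ldots,\xi_{n-1},u)$ with $\ell<\xi_1<\cdots<\xi_{n-1}<u$. Then for each $i=1,2,\ldots,n-1$, $\xi_i(p)$ is increasing in $p$ on $(1,\infty)$.
   Context: For every $p>1$ the minimizer in question exists and is unique. Let $f(x):=x^p$ on $[\ell,u]$. Write $\xi_0:=\ell$, $\xi_n:=u$, put $\tau_0:=\ell$, $\tau_{n+1}:=u$ and, for $i=1,\ldots,n$, $$\tau_i:=\frac{[f(\xi_i)-f'(\xi_i)\xi_i]-[f(\xi_{i-1})-f'(\xi_{i-1})\xi_{i-1}]}{f'(\xi_{i-1})-f'(\xi_i)},$$ the abscissa of the intersection of the tangent lines to $f$ at $\xi_{i-1}$ and $\xi_i$. Let $g:[\ell,u]\to\mathbb{R}$ be the piecewise-linear function whose graph connects, in order, $(\ell,f(\ell))$, the points $(\tau_i,\ f(\xi_i)+f'(\xi_i)(\tau_i-\xi_i))$ for $i=1,\ldots,n$, and $(u,f(u))$. With $s:=\frac{f(u)-f(\ell)}{u-\ell}$, the set $\breve{U}^*_p(\boldsymbol\xi)$ is the closure of the convex hull of $$\left\{(x,y,z)\in\mathbb{R}^3:\ (f(\ell)-s\ell)z+sx\ge y\ge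 z\,g(x/z),\ uz\ge x\ge \ell z,\ 1\ge z>0,\ y\ge 0\right\}.$$ $\operatorname{vol}$ denotes 3-dimensional volume. *)

(* Defs.v *)
From HB Require Import structures.
From mathcomp Require Import all_boot all_order all_algebra.
From mathcomp Require Import all_classical all_reals all_analysis.

Set Implicit Arguments.
Unset Strict Implicit.
Unset Printing Implicit Defensive.

Import Order.TTheory GRing.Theory Num.Theory.
Import numFieldNormedType.Exports.

Local Open Scope classical_set_scope.
Local Open Scope ring_scope.

Definition convex_hull (R : realType) (M : lmodType R) (A : set M) : set M :=
  smallest (@convex_set R M) A.

(* Connects the points a :: s by segments, in order (abscissas increasing). The
   value to the right of the last point is irrelevant. *)
Fixpoint polyline (R : realType) (a : R * R) (s : seq (R * R)) (x : R) : R :=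
  if s is b :: s' then
    if x <= b.1 then a.2 + (b.2 - a.2) / (b.1 - a.1) * (x - a.1)
    else polyline b s' x
  else a.2.

Section PiecewiseLinearUnderEstimator.
Variables (R : realType) (l u p : R) (n : nat).

Definition powf (x : R) : R := x `^ p.

(* The derivative of powf on [0, +oo[, one-sided at 0: for p > 1 the value at 0
   is 0. The library's derivative is two-sided, and powR is not meaningful at
   negative reals. *)
Definition dpowf (x : R) : R := p * x `^ (p - 1).

Definition feasible (xi : n.+1.-tuple R) : Prop :=
  [/\ xi`_0 = l, xi`_n = u & forall i, (i < n)%N -> xi`_i < xi`_i.+1].

Variable xi : n.+1.-tuple R.

Definition tau (i : nat) : R :=
  if i == 0%N then l
  else if i == n.+1 then u
  else ((powf xi`_i - dpowf xi`_i * xi`_i)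
        - (powf xi`_i.-1 - dpowf xi`_i.-1 * xi`_i.-1))
       / (dpowf xi`_i.-1 - dpowf xi`_i).

Definition pl_under : R -> R :=
  polyline (l, powf l)
    (rcons [seq (tau i, powf xi`_i + dpowf xi`_i * (tau i - xi`_i))
           | i <- iota 1 n] (u, powf u)).

Definition secant_slope : R := (powf u - powf l) / (u - l).

Definition perspective_set : set (R^o * R^o * R^o) :=
  [set w | let: (x, y, z) := w in
    [/\ z * pl_under (x / z) <= y
          <= (powf l - secant_slope * l) * z + secant_slope * x,
        l * z <= x <= u * z,
        0 < z <= 1
      & 0 <= y]].

Definition Ustar : set (R * R * R) :=
  @closure (R * R * R)%type (convex_hull perspective_set).

End PiecewiseLinearUnderEstimator.

Definition vol (R : realType) : set (R * R * R) -> \bar R :=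
  ((@lebesgue_measure R \x @lebesgue_measure R) \x @lebesgue_measure R)%E.

Definition is_minimizer (R : realType) (l u p : R) (n : nat)
    (xi : n.+1.-tuple R) : Prop :=
  feasible l u xi /\
  forall xi' : n.+1.-tuple R, feasible l u xi' ->
    (vol (Ustar l u p xi) <= vol (Ustar l u p xi'))%E.

(* Main.v *)
From HB Require Import structures.
Require Import Defs.
From mathcomp Require Import all_boot all_order all_algebra.
From mathcomp Require Import all_classical all_reals all_analysis.
From mathcomp Require Import measurable_realfun ring lra.
Import Order.TTheory GRing.Theory Num.Theory.
Import numFieldNormedType.Exports.
Set Implicit Arguments.
Unset Strict Implicit.
Unset Printing Implicit Defensive.
Local Open Scope classical_set_scope.
Local Open Scope ring_scope.

(** The relaxation is, up to its apex, the cone of heights [z] in [0, 1] over the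
    plane region between the secant of [x `^ p] and the under-estimator [g].
    Its slice at height [z] is that region scaled by [z], so its volume is a third
    of the area of the region ([vol_Ustar]), and minimizing the volume means
    maximizing the integral of [g].

    On [l, u] the function [g] is the largest of the tangents at the nodes
    ([pl_under_envelope]), the tangent at [xi_i] being active between the
    breakpoints [tau_i] and [tau_(i+1)].  The integral of a tangent over
    [tau_i, tau_(i+1)] is the length times its value at the midpoint [m], and by
    strict convexity that value is largest for the tangent at [m] itself.  So if
    [xi_i <> m], moving the node [xi_i] to [m] strictly increases the integral: on
    [tau_i, tau_(i+1)] by this remark, elsewhere because the formerly active
    tangent is still among the competitors ([envelope_improvement]).  Hence each
    interior node of a minimizer is the midpoint of its two neighbouring
    breakpoints, [xi_i *+ 2 = tau_i + tau_(i+1)] ([minimizer_balanced]).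

    The breakpoint between two nodes [a < b] is a mean [crossing p a b] of [a] and
    [b]: the mean of [t] over [a, b] for the weight [t `^ (p - 2)].  It is
    homogeneous, nondecreasing in [a] and in [b], and strictly increasing in [p]
    because a larger [p] shifts the weight to the right ([crossing_increasing]).
    A maximum principle then compares the balanced nodes [x] for [p] with the
    balanced nodes [y] for [q > p] ([balanced_lt]).  Let [c] be the largest of the
    ratios [x_i / y_i] over the interior nodes, reached at [j].  If [c >= 1], then
    [x_k <= c * y_k] for every [k], the endpoints included, and
    [[
      2 x_j = crossing p x_(j-1) x_j + crossing p x_j x_(j+1)
           <= c (crossing p y_(j-1) y_j + crossing p y_j y_(j+1))
            < c (crossing q y_(j-1) y_j + crossing q y_j y_(j+1)) = 2 c y_j,
    ]]
    which contradicts [x_j = c * y_j].  So [c < 1]. *)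

(** * Tangent lines of the power function *)

Section Tangents.
Variable R : realType.
Implicit Types p q a b c x tau : R.

Definition tangent p a x := powf p a + dpowf p a * (x - a).

(** The abscissa at which the tangents at [a] and [b] meet. *)
Definition crossing p a b :=
  ((powf p b - dpowf p b * b) - (powf p a - dpowf p a * a))
  / (dpowf p a - dpowf p b).

Lemma tangent_id p a : tangent p a a = powf p a.
Proof. by rewrite /tangent subrr mulr0 addr0. Qed.

Lemma mul_dpowf p a : 1 < p -> 0 <= a -> dpowf p a * a = p * powf p a.
Proof.
by move=> p1 a0; rewrite /dpowf -mulrA [_ * a]mulrC mulr_powRB1// (lt_trans ltr01).
Qed.

Lemma tangentE p a x : 1 < p -> 0 <= a ->
  tangent p a x = (1 - p) * powf p a + dpowf p a * x.
Proof. by move=> p1 a0; rewrite /tangent mulrBr mul_dpowf//; ring. Qed.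

(** For positive [a] and [x] this is the weighted inequality between arithmetic
    and geometric means,
    [x * a `^ (p - 1) < p^-1 * x `^ p + (1 - p^-1) * a `^ p], proved by factoring
    out the geometric mean and applying [1 + t < expR t]. *)
Lemma tangent_lt_powf p a x : 1 < p -> 0 <= a -> 0 <= x -> x != a ->
  tangent p a x < powf p x.
Proof.
move=> p1 a0 x0 xa; rewrite tangentE//.
have p0 : 0 < p by lra.
have pN0 : p != 0 by lra.
have p1N0 : p - 1 != 0 by lra.
move: a0 x0 xa; rewrite !le_eqVlt => /predU1P[<-|a0] /predU1P[<-|x0] xa.
- by rewrite eqxx in xa.
- by rewrite /dpowf /powf !powR0// !mulr0 mul0r addr0 powR_gt0.
- rewrite /powf mulr0 addr0 [0 `^ _]powR0// nmulr_rlt0 ?powR_gt0//; lra.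
have lnax : ln x - ln a != 0.
  by rewrite subr_eq0; apply: contra_neq xa => /ln_inj; apply.
have t1 : (p - 1) * (ln x - ln a) != 0 by rewrite mulf_neq0.
have t2 : - (ln x - ln a) != 0 by rewrite oppr_eq0.
have e1 := expR_gt1Dx t1; have e2 := expR_gt1Dx t2.
(* the geometric mean [x * a `^ (p - 1)] *)
pose M := expR (ln x + (p - 1) * ln a).
have M0 : 0 < M by exact: expR_gt0.
have Ex : powf p x = M * expR ((p - 1) * (ln x - ln a)).
  by rewrite /powf /powR gt_eqF// -expRD; congr expR; ring.
have Ea : powf p a = M * expR (- (ln x - ln a)).
  by rewrite /powf /powR gt_eqF// -expRD; congr expR; ring.
have Em : dpowf p a * x = p * M.
  rewrite /dpowf -mulrA; congr (_ * _); rewrite /powR gt_eqF//.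
  by rewrite -{1}(lnK x0) -expRD addrC.
rewrite Em Ex Ea.
set t := ln x - ln a in e1 e2 *.
set A := expR _ in e1 *; set B := expR _ in e2 *.
rewrite -subr_gt0.
have -> : M * A - ((1 - p) * (M * B) + p * M) = M * (A + (p - 1) * B - p) by ring.
by apply: mulr_gt0 => //; nra.
Qed.

Lemma dpowf_lt p a b : 1 < p -> 0 <= a -> a < b -> dpowf p a < dpowf p b.
Proof.
move=> p1 a0 ab; rewrite /dpowf ltr_pM2l; last lra.
apply: gt0_ltr_powR => //; rewrite ?nnegrE//; lra.
Qed.

Lemma dpowf_ge0 p a : 1 < p -> 0 <= dpowf p a.
Proof. by move=> p1; rewrite mulr_ge0 ?powR_ge0//; lra. Qed.

Lemma tangentB p a b x : 1 < p -> 0 <= a -> a < b ->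
  tangent p b x - tangent p a x
  = (dpowf p b - dpowf p a) * (x - crossing p a b).
Proof.
move=> p1 a0 ab; have ne := dpowf_lt p1 a0 ab.
rewrite /tangent /crossing; field; lra.
Qed.

Lemma le_tangent p a b x : 1 < p -> 0 <= a -> a < b ->
  (tangent p a x <= tangent p b x) = (crossing p a b <= x).
Proof.
move=> p1 a0 ab; rewrite -subr_ge0 tangentB// pmulr_rge0 ?subr_ge0//.
by rewrite subr_gt0 dpowf_lt.
Qed.

Lemma ge_tangent p a b x : 1 < p -> 0 <= a -> a < b ->
  (tangent p b x <= tangent p a x) = (x <= crossing p a b).
Proof.
move=> p1 a0 ab; rewrite -subr_le0 tangentB// pmulr_rle0 ?subr_le0//.
by rewrite subr_gt0 dpowf_lt.
Qed.

Lemma tangent_crossing p a b : 1 < p -> 0 <= a -> a < b ->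
  tangent p b (crossing p a b) = tangent p a (crossing p a b).
Proof.
move=> p1 a0 ab; apply: le_anti.
by rewrite (@le_tangent p a b)// (@ge_tangent p a b)// lexx.
Qed.

Lemma crossing_gt p a b : 1 < p -> 0 <= a -> a < b -> a < crossing p a b.
Proof.
move=> p1 a0 ab; rewrite ltNge -le_tangent// -ltNge tangent_id.
by apply: tangent_lt_powf; rewrite ?(ltW (le_lt_trans a0 ab))// lt_eqF.
Qed.

Lemma crossing_lt p a b : 1 < p -> 0 <= a -> a < b -> crossing p a b < b.
Proof.
move=> p1 a0 ab; rewrite ltNge -ge_tangent// -ltNge tangent_id.
by apply: tangent_lt_powf; rewrite ?(ltW (le_lt_trans a0 ab))// gt_eqF.
Qed.

(** For [a < b < b'], the tangent at [b'] lies below the one at [b] to the left of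
    [b], in particular where the latter meets the tangent at [a]; so the tangents
    at [a] and [b'] meet further right. *)
Lemma crossing_le_r p a b b' : 1 < p -> 0 <= a -> a < b -> b <= b' ->
  crossing p a b <= crossing p a b'.
Proof.
move=> p1 a0 ab; rewrite le_eqVlt => /predU1P[->//|bb'].
rewrite -(@ge_tangent p a b') ?(lt_trans ab)// -tangent_crossing//.
have b0 := le_trans a0 (ltW ab).
rewrite (@ge_tangent p b b')// ltW// (lt_trans (crossing_lt p1 a0 ab))//.
exact: crossing_gt.
Qed.

Lemma crossing_le_l p a a' b : 1 < p -> 0 <= a -> a <= a' -> a' < b ->
  crossing p a b <= crossing p a' b.
Proof.
move=> p1 a0; rewrite le_eqVlt => /predU1P[->//|aa'] a'b.
have a'0 := le_trans a0 (ltW aa').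
rewrite -(@le_tangent p a b) ?(lt_trans aa')// tangent_crossing//.
rewrite (@le_tangent p a a')// ltW// (lt_trans (crossing_lt p1 a0 aa'))//.
exact: crossing_gt.
Qed.

Lemma crossing_homogeneous p a b c : 1 < p -> 0 <= a -> a < b -> 0 < c ->
  crossing p (c * a) (c * b) = c * crossing p a b.
Proof.
move=> p1 a0 ab c0; have b0 := le_trans a0 (ltW ab).
have ne := dpowf_lt p1 a0 ab.
have dE x : 0 <= x -> dpowf p (c * x) = c `^ (p - 1) * dpowf p x.
  by move=> x0; rewrite /dpowf powRM ?(ltW c0)//; ring.
have fE x : 0 <= x -> powf p (c * x) = c * c `^ (p - 1) * powf p x.
  move=> x0; rewrite /powf powRM ?(ltW c0)// mulr_powRB1//; lra.
have cp : 0 < c `^ (p - 1) by exact: powR_gt0.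
rewrite /crossing !dE// !fE//; field.
have d0 : dpowf p a - dpowf p b != 0 by lra.
by rewrite d0 -(mulrBr (c `^ _)) mulf_neq0// gt_eqF.
Qed.

Lemma crossing0 p b : 1 < p -> 0 < b -> crossing p 0 b = (1 - p^-1) * b.
Proof.
move=> p1 b0; have pN0 : p != 0 by lra.
rewrite /crossing mulr0 mul_dpowf ?(ltW b0)//.
have -> : dpowf p 0 = 0 by rewrite /dpowf powR0 ?mulr0//; lra.
rewrite [powf p 0]powR0// /powf -mulr_powRB1 ?(ltW b0)//; last lra.
rewrite /dpowf; have cp : 0 < b `^ (p - 1) by exact: powR_gt0.
field; rewrite (gt_eqF cp) /=; lra.
Qed.

(** An antiderivative of [t |-> (t - tau) * t `^ (p - 2)].  By
    [moment_primitiveB] its increment over [a, b] has the sign of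
    [crossing p a b - tau], which says that the crossing is the mean of [t] over
    [a, b] for the weight [t `^ (p - 2)]. *)
Definition moment_primitive p tau x := x `^ p / p - tau * (x `^ (p - 1) / (p - 1)).

Lemma moment_primitiveB p tau a b : 1 < p -> 0 <= a -> a < b ->
  moment_primitive p tau b - moment_primitive p tau a =
  (b `^ (p - 1) - a `^ (p - 1)) / (p - 1) * (crossing p a b - tau).
Proof.
move=> p1 a0 ab; have b0 := le_trans a0 (ltW ab).
have := dpowf_lt p1 a0 ab; rewrite /crossing /moment_primitive !mul_dpowf//.
rewrite /dpowf /powf ltr_pM2l; last lra.
move=> ne; have ne' : p * a `^ (p - 1) < p * b `^ (p - 1).
  by rewrite ltr_pM2l//; lra.
field; lra.
Qed.

Lemma is_derive_moment p tau x : 1 < p -> 0 < x ->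
  is_derive x 1 (moment_primitive p tau) ((x - tau) * x `^ (p - 2)).
Proof.
move=> p1 x0; have pE : p - 1 - 1 = p - 2 by ring.
rewrite (_ : moment_primitive p tau = p^-1 *: (@powR R)^~ p
                            - (tau / (p - 1)) *: (@powR R)^~ (p - 1)); last first.
  apply/funext => y; rewrite /moment_primitive !fctE /GRing.scale /=; ring.
have dpow r : is_derive x 1 ((@powR R)^~ r) (r * x `^ (r - 1)).
  exact: is_derive1_powR.
apply: is_derive_eq.
rewrite /GRing.scale /= pE.
have -> : x `^ (p - 1) = x * x `^ (p - 2).
  have -> : p - 1 = 1 + (p - 2) by ring.
  by rewrite (@powRD _ x 1) ?(gt_eqF x0) ?implybT// powRr1// ltW.
field; lra.
Qed.

(** Let [tau] be the crossing for [p].  Passing from [p] to [q] multiplies the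
    weight by [t `^ (q - p)].  Subtracting [tau `^ (q - p)] times the first moment
    for [p], which vanishes, makes the integrand
    [(t - tau) * t `^ (p - 2) * (t `^ (q - p) - tau `^ (q - p))], positive off
    [tau]; so the moment about [tau] for [q] is positive. *)
Lemma crossing_increasing p q a b : 1 < p -> p < q -> 0 <= a -> a < b ->
  crossing p a b < crossing q a b.
Proof.
move=> p1 pq a0 ab; have q1 := lt_trans p1 pq.
(* The weight may be singular at 0, so a left end at 0 is computed explicitly. *)
move: a0 ab; rewrite le_eqVlt => /predU1P[<- b0|a0 ab].
  rewrite !crossing0// ltr_pM2r// ltrD2l ltrN2 ltf_pV2// posrE; lra.
set tau := crossing p a b.
have ta : a < tau by apply: crossing_gt; rewrite ?ltW.
have tb : tau < b by apply: crossing_lt; rewrite ?ltW.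
pose H x := moment_primitive q tau x - tau `^ (q - p) * moment_primitive p tau x.
pose H' x := (x - tau) * x `^ (p - 2) * (x `^ (q - p) - tau `^ (q - p)).
have dH x : 0 < x -> is_derive x 1 H (H' x).
  move=> x0; have d1 := is_derive_moment tau p1 x0.
  have d2 := is_derive_moment tau q1 x0.
  rewrite (_ : H = moment_primitive q tau
                   - (tau `^ (q - p)) *: moment_primitive p tau)//.
  apply: is_derive_eq.
  rewrite /GRing.scale /= /H'.
  have -> : q - 2 = (p - 2) + (q - p) by ring.
  rewrite powRD ?(gt_eqF x0) ?implybT//; ring.
have H'gt0 x : 0 < x -> x != tau -> 0 < H' x.
  move=> x0; have xp : 0 < x `^ (p - 2) by exact: powR_gt0.
  rewrite neq_lt => /orP[xt|tx].
    rewrite /H' nmulr_rgt0.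
      rewrite subr_lt0; apply: gt0_ltr_powR => //; rewrite ?nnegrE; lra.
    rewrite nmulr_rlt0// subr_lt0//.
  rewrite /H' pmulr_rgt0.
    rewrite subr_gt0; apply: gt0_ltr_powR => //; rewrite ?nnegrE; lra.
  by rewrite pmulr_rgt0// subr_gt0.
have Hincr c d : 0 < c -> c < d -> (forall x, c < x < d -> x != tau) ->
    H c < H d.
  move=> c0 cd ctd.
  apply: (@gtr0_derive1_lt_cc _ H c d) => //; rewrite ?in_itv/= ?lexx ?ltW//.
  - by move=> x; rewrite in_itv/= => /andP[cx _]; have [] := dH x (lt_trans c0 cx).
  - move=> x; rewrite in_itv/= => cxd; have /andP[cx _] := cxd.
    have x0 := lt_trans c0 cx.
    by rewrite derive1E; have [_ ->] := dH x x0; apply: H'gt0 => //; exact: ctd.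
  - apply: continuous_in_subspaceT => x; rewrite inE/= in_itv/= => /andP[cx _].
    have [/derivable1_diffP/differentiable_continuous//] :=
      dH x (lt_le_trans c0 cx).
have Hat : H a < H tau by apply: Hincr => // x /andP[_ xt]; rewrite lt_eqF.
have Htb : H tau < H b.
  by apply: Hincr => // [|x /andP[tx _]]; rewrite ?gt_eqF// (lt_trans a0).
have : 0 < H b - H a by rewrite subr_gt0 (lt_trans Hat).
have -> : H b - H a = (moment_primitive q tau b - moment_primitive q tau a)
    - tau `^ (q - p) * (moment_primitive p tau b - moment_primitive p tau a).
  by rewrite /H; ring.
rewrite !moment_primitiveB ?ltW// subrr mulr0 mulr0 subr0 pmulr_rgt0 ?subr_gt0//.
apply: divr_gt0; last lra.
by rewrite subr_gt0; apply: gt0_ltr_powR; rewrite ?nnegrE; lra.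
Qed.

Lemma continuous_tangent p a : continuous (tangent p a).
Proof.
move=> t; rewrite /tangent; apply: cvgD; first exact: cvg_cst.
by apply: cvgM; [exact: cvg_cst|apply: cvgB; [exact: cvg_id|exact: cvg_cst]].
Qed.

End Tangents.

(** * Comparison of the balanced sequences of two exponents *)

Section Comparison.
Variable R : realType.
Implicit Types (p q : R) (x y : nat -> R).

(** The optimality condition for the interior nodes. *)
Definition balanced p n x := forall i, (0 < i < n)%N ->
  crossing p (x i.-1) (x i) + crossing p (x i) (x i.+1) = x i *+ 2.

(** A maximum principle for the ratios [x k / y k]: by homogeneity one may scale
    [y] until it touches [x] from above at an interior node, and there the strict
    growth of the crossing in the exponent is contradictory. *)
Lemma balanced_lt p q n x y : 1 < p -> p < q -> 0 <= x 0%N ->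
  (forall i, (i < n)%N -> x i < x i.+1) ->
  (forall i, (i < n)%N -> y i < y i.+1) ->
  x 0%N = y 0%N -> x n = y n -> balanced p n x -> balanced q n y ->
  forall i, (0 < i < n)%N -> x i < y i.
Proof.
move=> p1 pq x00 xS yS x0y0 xnyn px qy i iP; have q1 := lt_trans p1 pq.
have pos (z : nat -> R) : (forall i, (i < n)%N -> z i < z i.+1) -> 0 <= z 0%N ->
    forall k, (k <= n)%N -> 0 <= z k.
  move=> zS z0; elim=> // k ih kn.
  by rewrite (le_trans (ih (ltnW kn)))// ltW// zS.
have x_ge0 := pos x xS x00.
have y_ge0 : forall k, (k <= n)%N -> 0 <= y k by apply: pos; rewrite -?x0y0.
have y_gt0 k : (0 < k <= n)%N -> 0 < y k.
  case: k => // k kn; exact: le_lt_trans (y_ge0 _ (ltnW kn)) (yS _ kn).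
rewrite ltNge; apply/negP => yxi.
have /andP[i0 in_] := iP.
have [j jP jmax] := @arg_maxP _ _ 'I_n (Ordinal in_) (fun k => (0 < k)%N)
  (fun k => x k / y k) i0.
have jn := ltn_ord j.
have yj0 : 0 < y j by rewrite y_gt0// jP ltnW.
set c := x j / y j.
have c1 : 1 <= c.
  apply: le_trans (jmax (Ordinal in_) i0).
  by rewrite ler_pdivlMr ?mul1r//= y_gt0// i0 ltnW.
have c0 : 0 < c by lra.
have xcy k : (k <= n)%N -> x k <= c * y k.
  move=> kn; have yk := y_ge0 _ kn; have [->|k0] := posnP k.
    by rewrite -x0y0 ler_peMl.
  move: kn; rewrite leq_eqVlt => /predU1P[->|kn].
    by rewrite -xnyn ler_peMl// x_ge0.
  by have := jmax (Ordinal kn) k0; rewrite /= ler_pdivrMr// y_gt0// k0 ltnW.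
have xj : x j = c * y j by rewrite divfK// gt_eqF.
have jE : (j : nat).-1.+1 = j by rewrite prednK.
have j1n : ((j : nat).-1 <= n)%N by exact: leq_trans (leq_pred _) (ltnW jn).
have yj1 : y j.-1 < y j by rewrite -[X in _ < y X]jE yS// jE ltnW.
have yj2 : y j < y j.+1 by exact: yS.
have jn1 : (j <= n)%N by exact: ltnW.
have yp := y_ge0 _ j1n; have yj := y_ge0 _ jn1.
have le1 : crossing p (x j.-1) (x j) <= c * crossing p (y j.-1) (y j).
  rewrite -crossing_homogeneous// xj.
  by apply: crossing_le_l; rewrite ?x_ge0 ?xcy// ltr_pM2l.
have le2 : crossing p (x j) (x j.+1) <= c * crossing p (y j) (y j.+1).
  rewrite -crossing_homogeneous// -xj.
  by apply: crossing_le_r; rewrite ?x_ge0 ?xcy ?xS.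
have lt1 : crossing p (y j.-1) (y j) < crossing q (y j.-1) (y j).
  by exact: crossing_increasing.
have lt2 : crossing p (y j) (y j.+1) < crossing q (y j) (y j.+1).
  by exact: crossing_increasing.
have := px j; rewrite jP jn => /(_ isT) ex.
have := qy j; rewrite jP jn => /(_ isT) ey.
have : x j *+ 2 < c * (y j *+ 2).
  rewrite -ex -ey; apply: (le_lt_trans (lerD le1 le2)).
  by rewrite -mulrDr ltr_pM2l// ltrD.
by rewrite mulrnAr -xj ltxx.
Qed.

End Comparison.

(** * The under-estimator as an upper envelope of tangents *)

Section Envelope.
Variables (R : realType) (l u p : R) (n : nat) (xi : n.+1.-tuple R).
Hypotheses (l_ge0 : 0 <= l) (p_gt1 : 1 < p) (n_gt0 : (0 < n)%N).
Hypothesis xi_feasible : feasible l u xi.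
Implicit Types (t : R) (i j k : nat).

Let xi0 : xi`_0 = l. Proof. by case: xi_feasible. Qed.
Let xin : xi`_n = u. Proof. by case: xi_feasible. Qed.
Let xiS i : (i < n)%N -> xi`_i < xi`_i.+1.
Proof. by case: xi_feasible => _ _; exact. Qed.

Lemma feasible_ge0 i : (i <= n)%N -> 0 <= xi`_i.
Proof.
elim: i => [|i ih] lin; first by rewrite xi0.
by rewrite (le_trans (ih (ltnW lin)))// ltW// xiS.
Qed.

Lemma tau0 : tau l u p xi 0 = l. Proof. by []. Qed.

Lemma tau_last : tau l u p xi n.+1 = u.
Proof. by rewrite /tau /= eqxx. Qed.

Lemma tauE i : (i < n)%N -> tau l u p xi i.+1 = crossing p xi`_i xi`_i.+1.
Proof. by move=> lin; rewrite /tau /= eqSS ltn_eqF. Qed.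

Lemma tau_le_node i : (i <= n)%N -> tau l u p xi i <= xi`_i.
Proof.
case: i => [|i] lin; first by rewrite xi0.
by rewrite tauE// ltW// crossing_lt ?feasible_ge0 ?xiS// ltnW.
Qed.

Lemma node_le_tau i : (i <= n)%N -> xi`_i <= tau l u p xi i.+1.
Proof.
rewrite leq_eqVlt => /predU1P[->|lin]; first by rewrite xin tau_last.
by rewrite tauE// ltW// crossing_gt ?feasible_ge0 ?xiS// ltnW.
Qed.

Lemma tau_lt_node i : (0 < i <= n)%N -> tau l u p xi i < xi`_i.
Proof.
case: i => // i /= lin; rewrite tauE// crossing_lt ?xiS// feasible_ge0//.
exact: ltnW.
Qed.

Lemma node_lt_tau i : (i < n)%N -> xi`_i < tau l u p xi i.+1.
Proof. by move=> lin; rewrite tauE// crossing_gt ?xiS// feasible_ge0// ltnW. Qed.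

Lemma tau_lt i : (i <= n)%N -> tau l u p xi i < tau l u p xi i.+1.
Proof.
case: i => [|i] lin; first by rewrite (le_lt_trans (tau_le_node _)) ?node_lt_tau.
by rewrite (lt_le_trans (tau_lt_node _)) ?node_le_tau.
Qed.

Lemma tau_le i j : (i <= j <= n.+1)%N -> tau l u p xi i <= tau l u p xi j.
Proof.
case/andP; elim: j => [|j ih]; first by rewrite leqn0 => /eqP ->.
rewrite leq_eqVlt => /predU1P[->//|ij] jn.
by rewrite (le_trans (ih ij (ltnW jn)))// ltW// tau_lt.
Qed.

(** Moving one node towards [j] at a time, the tangent can only go up at [t]:
    two consecutive tangents exchange order exactly at the corresponding
    breakpoint. *)
Lemma tangent_le_active i j t : (i <= n)%N -> (j <= n)%N ->
  tau l u p xi j <= t <= tau l u p xi j.+1 ->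
  tangent p xi`_i t <= tangent p xi`_j t.
Proof.
move=> lin jn /andP[tj tj1].
have up k : (k <= j)%N -> tangent p xi`_i t <= tangent p xi`_k t \/ (k < i)%N.
  elim: k => [|k ih] kj; first by case: i lin => [|i]; [left|right].
  have kn : (k < n)%N by exact: leq_trans kj jn.
  have [ik|] := leqP i k; last first.
    by rewrite leq_eqVlt => /predU1P[<-|]; [left|right].
  have [ih'|] := ih (ltnW kj); last by rewrite ltnNge ik.
  left; apply: (le_trans ih').
  rewrite (@le_tangent _ p xi`_k xi`_k.+1) ?xiS ?feasible_ge0// ?(ltnW kn)//.
  by rewrite -tauE// (le_trans _ tj)// tau_le// kj (leqW jn).
have down k : (j + k <= n)%N ->
    tangent p xi`_(j + k) t <= tangent p xi`_j t.
  elim: k => [|k ih]; first by rewrite addn0.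
  rewrite addnS => kn; apply: le_trans (ih (ltnW kn)).
  rewrite (@ge_tangent _ p xi`_(j + k) xi`_(j + k).+1) ?xiS ?feasible_ge0//.
    by rewrite -tauE// (le_trans tj1)// tau_le// ltnS leq_addr ltnS ltnW.
  exact: ltnW.
have [ij|ji] := leqP i j.
  by have [//|] := up j (leqnn _); rewrite ltnNge ij.
by have := down (i - j)%N; rewrite subnKC ?(ltnW ji)//; apply.
Qed.

(** The first tangent is also the unit of the maximum, so that the maximum is over
    the tangents alone. *)
Definition envelope t :=
  \big[Num.max/tangent p xi`_0 t]_(i < n.+1) tangent p xi`_i t.

Lemma envelope_leP t y :
  envelope t <= y <-> forall i, (i <= n)%N -> tangent p xi`_i t <= y.
Proof.
split=> [/bigmax_leP[_ yP] i lin|yP].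
  by have := yP (Ordinal (lin : (i < n.+1)%N)) isT.
by apply/bigmax_leP; split=> [|i _]; exact: yP (leq_ord i) || exact: yP.
Qed.

Lemma tangent_le_envelope i t : (i <= n)%N -> tangent p xi`_i t <= envelope t.
Proof. by move=> lin; have /envelope_leP := lexx (envelope t); exact. Qed.

Lemma envelopeE j t : (j <= n)%N ->
  tau l u p xi j <= t <= tau l u p xi j.+1 -> envelope t = tangent p xi`_j t.
Proof.
move=> jn tP; apply/le_anti/andP; split; last exact: tangent_le_envelope.
by apply/envelope_leP => i lin; exact: tangent_le_active.
Qed.

Lemma continuous_envelope : continuous envelope.
Proof.
rewrite /envelope => t; elim: (index_enum _) => [|i r ih].
  rewrite (_ : (fun _ => _) = tangent p xi`_0); first exact: continuous_tangent.
  by apply/funext => s; rewrite big_nil.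
rewrite (_ : (fun _ => _) = tangent p xi`_i \max
    (fun s => \big[Num.max/tangent p xi`_0 s]_(i <- r) tangent p xi`_i s)).
  by apply: continuous_max => //; exact: continuous_tangent.
by apply/funext => s; rewrite big_cons.
Qed.

Let affine a r s t : r != s ->
  tangent p a s + (tangent p a r - tangent p a s) / (r - s) * (t - s)
  = tangent p a t.
Proof. by move=> rs; rewrite /tangent; field; rewrite subr_eq0. Qed.

(* From the breakpoint [tau k] on, the polyline follows the tangent at [xi_k]: its
   next vertex is placed on the tangent at [xi_(k+1)], at its crossing with that
   one. *)
Let polyline_active m k t : (k + m = n)%N -> tau l u p xi k <= t <= u ->
  exists j, [/\ (j <= n)%N, tau l u p xi j <= t <= tau l u p xi j.+1 &
    polyline (tau l u p xi k, tangent p xi`_k (tau l u p xi k))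
    (rcons [seq (tau l u p xi i, tangent p xi`_i (tau l u p xi i))
           | i <- iota k.+1 m] (u, powf p u)) t = tangent p xi`_j t].
Proof.
elim: m k => [|m ih] k kmn /andP[tk tu].
  have kE : k = n by rewrite -kmn addn0.
  exists n; rewrite leqnn tau_last; split=> //.
    by rewrite -[X in tau _ _ _ _ X]kE tk.
  have uE : powf p u = tangent p xi`_n u by rewrite xin tangent_id.
  rewrite /= tu kE uE affine//.
  by rewrite gt_eqF// -[X in _ < X]tau_last tau_lt.
have kn : (k < n)%N by rewrite -kmn addnS ltnS leq_addr.
rewrite /=; case: leP => [tk1|/ltW k1t].
  exists k; rewrite (ltnW kn) tk tk1; split=> //.
  have -> : tangent p xi`_k.+1 (tau l u p xi k.+1)
          = tangent p xi`_k (tau l u p xi k.+1).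
    by rewrite tauE// tangent_crossing ?xiS ?feasible_ge0// ltnW.
  by rewrite affine// gt_eqF// tau_lt// ltnW.
by apply: ih; rewrite ?addSnnS// k1t.
Qed.

Lemma pl_under_envelope t : l <= t <= u -> pl_under l u p xi t = envelope t.
Proof.
move=> tP; have [j [jn tj jE]] := @polyline_active n 0 t erefl tP.
rewrite (envelopeE jn tj) -jE /pl_under tau0.
by rewrite xi0 tangent_id.
Qed.

Lemma active_tangent t : l <= t <= u ->
  exists2 j, (j <= n)%N & tau l u p xi j <= t <= tau l u p xi j.+1.
Proof. by move=> /(@polyline_active n 0 t erefl)[j [jn tj _]]; exists j. Qed.

End Envelope.

(** * Optimal nodes are balanced *)

Section Balance.
Variables (R : realType).
Implicit Types (a b l u p m : R).
Local Notation mu := (@lebesgue_measure R).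

Lemma integral_affine (c d a b : R) : a < b ->
  (\int[mu]_(x in `[a, b]) (c + d * x))%R = (b - a) * (c + d * ((a + b) / 2)).
Proof.
move=> ab; pose F x := c * x + d / 2 * (x * x).
have dF (x : R) : is_derive x 1 F (c + d * x).
  rewrite (_ : F = c *: id + (d / 2) *: (id * id)); last first.
    by apply/funext => y; rewrite /F !fctE.
  by apply: is_derive_eq; rewrite /GRing.scale /=; field.
have cF : continuous (F : R -> R).
  by move=> x; have [/derivable1_diffP/differentiable_continuous] := dF x.
rewrite /Rintegral (@continuous_FTC2 _ _ F)//.
- by rewrite /F /=; field.
- apply: continuous_subspaceT => x; apply: cvgD; first exact: cvg_cst.
  by apply: cvgM; [exact: cvg_cst|exact: cvg_id].
- split.
  + by move=> x _; have [] := dF x.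
  + by apply: cvg_at_right_filter; exact: cF.
  + by apply: cvg_at_left_filter; exact: cF.
- by move=> x _; rewrite derive1E; have [_ ->] := dF x.
Qed.

Lemma continuous_integrable (f : R -> R) a b : continuous f ->
  mu.-integrable `[a, b] (EFin \o f).
Proof.
move=> cf; apply: continuous_compact_integrable; first exact: segment_compact.
exact: continuous_subspaceT.
Qed.

Definition move_node n (xi : n.+1.-tuple R) i m : n.+1.-tuple R :=
  [tuple if j == i :> nat then m else xi`_j | j < n.+1].

Lemma nth_move_node n (xi : n.+1.-tuple R) i m j : (j <= n)%N ->
  (move_node xi i m)`_j = if j == i then m else xi`_j.
Proof.
by move=> jn; have := nth_mktuple (fun j : 'I_n.+1 =>
  if j == i :> nat then m else xi`_j) 0 (Ordinal (jn : (j < n.+1)%N)).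
Qed.

Lemma feasible_move_node l u n (xi : n.+1.-tuple R) i m : (0 < i < n)%N ->
  feasible l u xi -> xi`_i.-1 < m < xi`_i.+1 -> feasible l u (move_node xi i m).
Proof.
move=> /andP[i0 lin] [x0 xn xS] /andP[m1 m2]; split.
- by rewrite nth_move_node// ltn_eqF.
- by rewrite nth_move_node// gtn_eqF.
move=> j jn; rewrite !nth_move_node//; last exact: ltnW.
have [ji|ji] := eqVneq j i; first by rewrite ji gtn_eqF.
have [j1i|_] := eqVneq j.+1 i; last exact: xS.
by move: m1; rewrite -j1i.
Qed.

(** The mean of a tangent over a segment is its value at the midpoint, which is
    largest for the tangent at the midpoint itself.  Away from
    [tau_i, tau_(i+1)] the envelope does not decrease, since there the active
    tangent is that of a node which has not moved. *)
Lemma envelope_improvement l u p n (xi : n.+1.-tuple R) i :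
  0 <= l -> 1 < p -> feasible l u xi -> (0 < i < n)%N ->
  let m := (tau l u p xi i + tau l u p xi i.+1) / 2 in m != xi`_i ->
  feasible l u (move_node xi i m) /\
  (\int[mu]_(t in `[l, u]) envelope p xi t <
   \int[mu]_(t in `[l, u]) envelope p (move_node xi i m) t)%R.
Proof.
move=> l0 p1 xif iP m mxi; have /andP[i0 lin] := iP.
have n0 : (0 < n)%N by exact: leq_ltn_trans lin.
have li := ltnW lin.
set a := tau l u p xi i in m mxi *; set b := tau l u p xi i.+1 in m mxi *.
have ai : a < xi`_i by apply: tau_lt_node => //; rewrite i0.
have ib : xi`_i < b by exact: node_lt_tau.
have ia : xi`_i.-1 < a.
  by rewrite /a -[X in tau _ _ _ _ X](prednK i0) node_lt_tau// prednK// ltnW.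
have bi : b < xi`_i.+1 by apply: tau_lt_node.
have la : l <= a by rewrite -(tau0 l u p xi); apply: tau_le => //; exact: leqW.
have bu : b <= u.
  rewrite -(tau_last l u p xi).
  by apply: tau_le; rewrite // ltnS leqnn andbT ltnW.
have fm : feasible l u (move_node xi i m).
  by apply: feasible_move_node => //; rewrite /m; apply/andP; split; lra.
split=> //.
have ab : a < b by rewrite (lt_trans ai).
pose q t := tangent p m t - tangent p xi`_i t.
have cq : continuous q by move=> t; apply: cvgB; exact: continuous_tangent.
have cE : continuous (envelope p xi) by exact: continuous_envelope.
have cE' : continuous (envelope p (move_node xi i m)).
  exact: continuous_envelope.
have q0 : 0 < (\int[mu]_(t in `[a, b]) q t)%R.
  have -> : q = fun t => (tangent p m 0 - tangent p xi`_i 0)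
                       + (dpowf p m - dpowf p xi`_i) * t.
    by apply/funext => t; rewrite /q /tangent; ring.
  rewrite integral_affine// mulr_gt0 ?subr_gt0//.
  rewrite (_ : _ + _ = tangent p m m - tangent p xi`_i m); last first.
    by rewrite /tangent -/m; ring.
  rewrite subr_gt0 tangent_id tangent_lt_powf//.
    exact: feasible_ge0 xif _ (ltnW lin).
  by rewrite /m; have := feasible_ge0 l0 xif (ltnW lin); lra.
rewrite -subr_gt0 -RintegralB//; try exact: continuous_integrable.
apply: (lt_le_trans q0).
have sub : `[a, b] `<=` `[l, u] by apply: subset_itvScc; rewrite bnd_simp.
rewrite -(setIidr sub) Rintegral_mkcondr.
apply: le_Rintegral => //.
- rewrite -restrict_EFin; apply/integrable_restrict => //.
  by rewrite (setIidr sub); exact: continuous_integrable.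
- by apply: continuous_integrable => t; apply: cvgB; [exact: cE'|exact: cE].
move=> t; rewrite /= in_itv /= => tlu; rewrite patchE.
case: ifPn => [|]; rewrite ?inE ?notin_setE /= in_itv /= => tab.
  rewrite (envelopeE l0 p1 n0 xif li tab) lerD2r.
  have := @tangent_le_envelope _ p n (move_node xi i m) i t li.
  by rewrite nth_move_node// eqxx.
have [j jn tj] := active_tangent l0 p1 n0 xif tlu.
have ji : j != i by by apply: contra_notN tab => /eqP ji; rewrite /a /b -ji.
rewrite (envelopeE l0 p1 n0 xif jn tj) subr_ge0.
have := @tangent_le_envelope _ p n (move_node xi i m) j t jn.
by rewrite nth_move_node// (negbTE ji).
Qed.

End Balance.

(** * Volume of a cone over a plane region between two graphs *)

Lemma product_measure12 d1 d2 (T1 : measurableType d1) (T2 : measurableType d2)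
  (R : realType)
  (m1 : {sigma_finite_measure set T1 -> \bar R})
  (m2 : {sigma_finite_measure set T2 -> \bar R}) (C : set (T1 * T2)) :
  measurable C -> (m1 \x m2)%E C = (m1 \x^ m2)%E C.
Proof.
move: C; apply: product_measure_unique => A B mA mB.
exact: product_measure2E.
Qed.

Section IteratedProduct.
Local Open Scope ereal_scope.
Context {d1 d2 d3 : measure_display} {T1 : measurableType d1}
  {T2 : measurableType d2} {T3 : measurableType d3} {R : realType}.
Variable m1 : {sigma_finite_measure set T1 -> \bar R}.
Variable m2 : {sigma_finite_measure set T2 -> \bar R}.
Variable m3 : {sigma_finite_measure set T3 -> \bar R}.

Lemma product_sigma_finite : sigma_finite setT (m1 \x m2).
Proof.
have [F TF Ffin] := sigma_finiteT m1; have [G TG Gfin] := sigma_finiteT m2.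
pose H k := let: (i, j) := odflt (0, 0)%N (unpickle k) in F i `*` G j.
exists H.
  apply/seteqP; split=> // -[x y] _.
  have [i _ Fi] : (\bigcup_i F i) x by rewrite -TF.
  have [j _ Gj] : (\bigcup_i G i) y by rewrite -TG.
  by exists (pickle (i, j)); rewrite // /H pickleK.
move=> k; rewrite /H; case: (odflt _ _) => i j.
have [mF Fy] := Ffin i; have [mG Gy] := Gfin j.
split; first exact: measurableX.
by rewrite product_measure1E// lte_mul_pinfty// ge0_fin_numE.
Qed.

(** The product under a name of its own, to carry the structure of a sigma-finite
    measure. *)
Definition sfprod : set (T1 * T2) -> \bar R := m1 \x m2.
HB.instance Definition _ := Measure.copy sfprod (m1 \x m2).
HB.instance Definition _ := Measure_isSigmaFinite.Build _ _ _ sfprod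
  product_sigma_finite.

(** The volume may be computed slice by slice along the last coordinate. *)
Lemma iterated_product_measure12 C : measurable C ->
  ((m1 \x m2) \x m3) C = ((m1 \x m2) \x^ m3) C.
Proof. exact: (@product_measure12 _ _ _ _ _ sfprod m3). Qed.

End IteratedProduct.

Section ConeVolume.
Variable R : realType.
Implicit Types (a b l u x y z : R) (lo hi : R -> R).
Local Notation mu := (@lebesgue_measure R).

Lemma region_area lo hi a b (S : set (R * R)) : measurable S ->
  (forall x, a <= x <= b -> lo x <= hi x) ->
  (forall x y, S (x, y) <-> (a <= x <= b) /\ (lo x <= y <= hi x)) ->
  (mu \x mu)%E S = (\int[mu]_(x in `[a, b]) (hi x - lo x)%:E)%E.
Proof.
move=> mS lohi SP; rewrite /product_measure1 [RHS]integral_mkcond.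
apply: eq_integral => x _; rewrite patchE /=.
case: ifPn => [|]; rewrite ?inE ?notin_setE /= in_itv /= => xab.
  have -> : xsection S x = `[lo x, hi x]%classic.
    apply/seteqP; split=> y; rewrite /xsection /= inE in_itv /=.
      by move=> /SP[].
    by move=> ?; apply/SP.
  rewrite lebesgue_measure_itv /= lte_fin; have := lohi x xab.
  by rewrite le_eqVlt => /predU1P[->|-> //]; rewrite ltxx subrr.
rewrite (_ : xsection S x = set0) ?measure0//.
apply/seteqP; split=> y //; rewrite /xsection /= inE => /SP[] //.
Qed.

Lemma integral_scaling (f : R -> R) a b z : continuous f -> a <= b -> 0 < z ->
  (\int[mu]_(x in `[(z * a)%R, (z * b)%R]) (z * f (x / z))%:E =
   (z ^+ 2)%:E * \int[mu]_(x in `[a, b]) (f x)%:E)%E.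
Proof.
move=> cf ab z0.
pose F x : R := z * x.
have dF (x : R) : is_derive x 1 F z.
  rewrite (_ : F = z *: id)//.
  by apply: is_derive_eq; rewrite /GRing.scale /= mulr1.
have F' : F^`()%classic = cst z.
  by apply/funext => x; rewrite derive1E; have [_ ->] := dF x.
have cF : continuous (F : R -> R).
  by move=> x; have [/derivable1_diffP/differentiable_continuous] := dF x.
rewrite -/(F a) -/(F b) (@integration_by_substitution_increasing _ F)//.
- rewrite F' -integralZl//; last first.
    apply: continuous_compact_integrable; first exact: segment_compact.
    exact: continuous_subspaceT.
  apply: eq_integral => x _; rewrite -EFinM; congr EFin => /=.
  by rewrite fctE /= /F [z * x]mulrC mulfK ?gt_eqF//; ring.
- by move=> x y _ _ xy; rewrite /F ltr_pM2l.
- by rewrite F' => x _; exact: cvg_cst.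
- by rewrite F'; exact: is_cvg_cst.
- by rewrite F'; exact: is_cvg_cst.
- split.
  + by move=> x _; have [] := dF x.
  + by apply: cvg_at_right_filter; exact: cF.
  + by apply: cvg_at_left_filter; exact: cF.
- apply: continuous_subspaceT => x; apply: cvgM; first exact: cvg_cst.
  apply: (@continuous_comp _ _ _ (fun x => x / z) f); last exact: cf.
  by apply: cvgM; [exact: cvg_id|exact: cvg_cst].
Qed.

Lemma integral_square (c : R) :
  (\int[mu]_(z in `[0%R, 1%R]) (z ^+ 2 * c)%:E)%E = (c / 3)%:E.
Proof.
pose F z := c / 3 * z ^+ 3.
have dF (z : R) : is_derive z 1 F (z ^+ 2 * c).
  rewrite (_ : F = (c / 3) *: (id ^+ 3)); last first.
    by apply/funext => y; rewrite /F !fctE.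
  by apply: is_derive_eq; rewrite /GRing.scale /= -mulr_natr; field.
have cF : continuous (F : R -> R).
  by move=> x; have [/derivable1_diffP/differentiable_continuous] := dF x.
rewrite (@continuous_FTC2 _ _ F)//.
- by rewrite -EFinB; congr EFin; rewrite /F; ring.
- apply: continuous_subspaceT => x; apply: cvgM; last exact: cvg_cst.
  exact: exprn_continuous.
- split.
  + by move=> x _; have [] := dF x.
  + by apply: cvg_at_right_filter; exact: cF.
  + by apply: cvg_at_left_filter; exact: cF.
- by move=> x _; rewrite derive1E; have [_ ->] := dF x.
Qed.

(** Slicing at height [z] gives the base scaled by [z], of area [z ^+ 2] times
    that of the base; hence the factor [1 / 3]. *)
Lemma cone_volume lo hi l u (C : set (R * R * R)) : l <= u ->
  continuous lo -> continuous hi ->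
  (forall x, l <= x <= u -> lo x <= hi x) -> measurable C ->
  (forall x y z, C (x, y, z) <->
     [/\ 0 <= z <= 1, l * z <= x <= u * z &
         z * lo (x / z) <= y <= z * hi (x / z)]) ->
  vol C = ((\int[mu]_(x in `[l, u]) (hi x - lo x))%R / 3)%:E.
Proof.
move=> lu clo chi lohi mC CP; rewrite /vol iterated_product_measure12//.
rewrite -integral_square [RHS]integral_mkcond /product_measure2.
apply: eq_integral => z _; rewrite patchE /=.
have mCz : measurable (ysection C z) by exact: measurable_ysection.
case: ifPn => [|]; rewrite ?inE ?notin_setE /= in_itv /= => z01; last first.
  rewrite (_ : ysection C z = set0) ?measure0//.
  by apply/seteqP; split=> -[x y] //; rewrite /ysection /= inE => /CP[].
have /andP[z0' z1] := z01.
have xlu x : 0 < z -> z * l <= x <= z * u -> l <= x / z <= u.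
  by move=> z0; rewrite ler_pdivlMr// ler_pdivrMr// [l * z]mulrC [u * z]mulrC.
rewrite (@region_area (fun x => z * lo (x / z)) (fun x => z * hi (x / z))
  (z * l) (z * u))//; first last.
- move=> x y; rewrite ![z * _]mulrC /ysection /= inE ![_ * z]mulrC.
  rewrite [z * l]mulrC [z * u]mulrC; split=> [/CP[]//|[xz yz]].
  exact/CP.
- move: z0'; rewrite le_eqVlt => /predU1P[<- x _|z0 x /(xlu x z0)/lohi].
    by rewrite !mul0r.
  by rewrite ler_pM2l.
under eq_integral do rewrite -mulrBr.
move: z0'; rewrite le_eqVlt => /predU1P[<-|z0].
  by rewrite !mul0r set_itv1 integral_set1 expr0n mul0r.
rewrite (@integral_scaling (fun x => hi x - lo x))//; last first.
  by move=> x; apply: cvgB; [exact: chi|exact: clo].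
rewrite [RHS]EFinM /Rintegral fineK//; apply: integrable_fin_num => //.
apply: continuous_integrable.
by move=> x; apply: cvgB; [exact: chi|exact: clo].
Qed.

End ConeVolume.

(** * The relaxation is a polyhedral cone over its base *)

Section Polyhedra.
Variable R : realType.
Implicit Types (c : R * R * R * R) (cs : seq (R * R * R * R)) (w : R * R * R).

Definition affine_form c w : R :=
  let: (c1, c2, c3, c0) := c in c1 * w.1.1 + c2 * w.1.2 + c3 * w.2 + c0.

Definition polyhedron cs : set (R * R * R) :=
  [set w | forall c, c \in cs -> 0 <= affine_form c w].

Lemma closed_polyhedron cs : closed (polyhedron cs).
Proof.
rewrite (_ : polyhedron cs =
  \bigcap_(c in [set` cs]) (affine_form c @^-1` [set t | 0 <= t])) //.
apply: closed_bigI => c _; apply: closed_comp; last exact: closed_ge.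
move=> w _; move: c => [[[c1 c2] c3] c0] /=.
apply: cvgD; last exact: cvg_cst.
apply: cvgD; last by apply: cvgM; [exact: cvg_cst|exact: cvg_snd].
apply: cvgD; apply: cvgM; try exact: cvg_cst.
- by apply: (@continuous_comp _ _ _ fst fst); exact: cvg_fst.
- by apply: (@continuous_comp _ _ _ fst snd); [exact: cvg_fst|exact: cvg_snd].
Qed.

Lemma measurable_polyhedron cs : measurable (polyhedron cs).
Proof.
elim: cs => [|c cs ih].
  rewrite (_ : polyhedron [::] = setT)//.
  by apply/seteqP; split.
have -> : polyhedron (c :: cs) =
    (setT `&` [set w | 0 <= affine_form c w]) `&` polyhedron cs.
  rewrite setTI; apply/seteqP; split=> w /=.
    move=> wP; split=> [|d dcs]; apply: wP; rewrite inE ?eqxx//.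
    by rewrite dcs orbT.
  by move=> [wc wcs] d; rewrite inE => /predU1P[->//|]; exact: wcs.
apply: measurableI => //; apply: measurable_fun_le => //.
move: c => [[[c1 c2] c3] c0] /=.
apply: measurable_funD => //.
apply: measurable_funD => //; last first.
  by apply: measurable_funM => //; exact: measurable_snd.
apply: measurable_funD; apply: measurable_funM => //.
- by apply: (@measurableT_comp _ _ _ _ _ _ fst); exact: measurable_fst.
- by apply: (@measurableT_comp _ _ _ _ _ _ snd);
    [exact: measurable_snd|exact: measurable_fst].
Qed.

End Polyhedra.

Section Relaxation.
Variables (R : realType) (l u p : R) (n : nat) (xi : n.+1.-tuple R).
Hypotheses (l_ge0 : 0 <= l) (l_lt_u : l < u) (p_gt1 : 1 < p) (n_gt0 : (0 < n)%N).
Hypothesis xi_feasible : feasible l u xi.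
Implicit Types (t x y z : R) (i : nat).

Let s := secant_slope l u p.

Definition secant t := (powf p l - s * l) + s * t.

(** The closed cone over the base of the relaxation, given by half-spaces so that
    closedness, measurability and convexity are immediate. *)
Definition cone_faces : seq (R * R * R * R) :=
  [:: (s, -1, powf p l - s * l, 0); (1, 0, - l, 0); (-1, 0, u, 0);
      (0, 0, 1, 0); (0, 0, -1, 1)]
  ++ [seq (- dpowf p xi`_i, 1, dpowf p xi`_i * xi`_i - powf p xi`_i, 0)
     | i <- iota 0 n.+1].

Lemma coneP x y z : polyhedron cone_faces (x, y, z) <->
  [/\ forall i, (i <= n)%N ->
        (powf p xi`_i - dpowf p xi`_i * xi`_i) * z + dpowf p xi`_i * x <= y,
      y <= (powf p l - s * l) * z + s * x,
      l * z <= x <= u * z & 0 <= z <= 1].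
Proof.
split=> [wP|[lo hi /andP[xl xu] /andP[z0 z1]] c].
  split.
  - move=> i lin; have := wP
      (- dpowf p xi`_i, 1, dpowf p xi`_i * xi`_i - powf p xi`_i, 0).
    rewrite mem_cat map_f ?orbT ?mem_iota//= => /(_ isT) /=; lra.
  - have := wP (s, -1, powf p l - s * l, 0).
    by rewrite !inE eqxx /= => /(_ isT); lra.
  - have := wP (1, 0, - l, 0); rewrite !inE eqxx !orbT /= => /(_ isT) h1.
    have := wP (-1, 0, u, 0); rewrite !inE eqxx !orbT /= => /(_ isT) h2.
    by apply/andP; split; lra.
  - have := wP (0, 0, 1, 0); rewrite !inE eqxx !orbT /= => /(_ isT) h1.
    have := wP (0, 0, -1, 1); rewrite !inE eqxx !orbT /= => /(_ isT) h2.
    by apply/andP; split; lra.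
rewrite mem_cat => /orP[|/mapP[i]].
  rewrite !inE => /or4P[/eqP->|/eqP->|/eqP->|/orP[]/eqP->] /=; lra.
rewrite mem_iota /= add0n => lin ->; have := lo i lin; rewrite /=; lra.
Qed.

Lemma continuous_secant : continuous secant.
Proof.
move=> t; apply: cvgD; first exact: cvg_cst.
by apply: cvgM; [exact: cvg_cst|exact: cvg_id].
Qed.

Lemma secant_l : secant l = powf p l.
Proof. by rewrite /secant; ring. Qed.

Lemma secant_u : secant u = powf p u.
Proof. by rewrite /secant /s /secant_slope; field; rewrite subr_eq0 gt_eqF. Qed.

(** A tangent lies below the secant at both ends of [l, u], hence on all of
    [l, u], both being affine. *)
Lemma envelope_le_secant t : l <= t <= u -> envelope p xi t <= secant t.
Proof.
move=> tlu; apply/envelope_leP => i lin.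
have x0 := feasible_ge0 l_ge0 xi_feasible lin.
have le r : 0 <= r -> tangent p xi`_i r <= powf p r.
  move=> r0; have [->|rx] := eqVneq r xi`_i; first by rewrite tangent_id.
  by rewrite ltW// tangent_lt_powf.
have := le l l_ge0; have := le u (le_trans l_ge0 (ltW l_lt_u)).
rewrite -secant_l -secant_u /secant /tangent.
set a := dpowf _ _; set b := powf p _; set c := powf p l; set e := xi`_i.
have /andP[lt tu] := tlu.
rewrite -(subr_ge0 (b + a * (u - e))) -(subr_ge0 (b + a * (l - e))) => hu hl.
have ul : 0 < u - l by rewrite subr_gt0.
rewrite -subr_ge0 -(pmulr_rge0 _ ul).
set d := (X in 0 <= X).
have -> : d = (u - t) * (c - s * l + s * l - (b + a * (l - e)))
            + (t - l) * (c - s * l + s * u - (b + a * (u - e))).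
  by rewrite /d; ring.
by rewrite addr_ge0// mulr_ge0// subr_ge0.
Qed.

(** Multiplied by [z > 0], the constraint [z * g (x / z) <= y] becomes a finite
    system of linear inequalities. *)
Lemma perspectiveP x y z :
  perspective_set l u p xi (x, y, z) <-> polyhedron cone_faces (x, y, z) /\ 0 < z.
Proof.
have key : 0 < z -> l * z <= x <= u * z ->
    z * pl_under l u p xi (x / z) <= y <-> forall i, (i <= n)%N ->
        (powf p xi`_i - dpowf p xi`_i * xi`_i) * z + dpowf p xi`_i * x <= y.
  move=> z0 /andP[xl xu]; have zN0 : z != 0 by rewrite gt_eqF.
  rewrite pl_under_envelope//; last by rewrite ler_pdivlMr// ler_pdivrMr// xl.
  rewrite mulrC -ler_pdivlMr//; split=> [/envelope_leP yP i lin|yP].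
    have := yP i lin; rewrite ler_pdivlMr//; apply: le_trans.
    by rewrite le_eqVlt; apply/orP; left; apply/eqP; rewrite /tangent; field.
  apply/envelope_leP => i lin; rewrite ler_pdivlMr//; apply: le_trans (yP i lin).
  by rewrite le_eqVlt; apply/orP; left; apply/eqP; rewrite /tangent; field.
split=> [[/andP[lo hi] xlu /andP[z0 z1] y0]|[/coneP[lo hi xlu /andP[_ z1]] z0]].
  split=> //; apply/coneP; split=> //; last by rewrite ltW.
  exact/key.
split=> //; last 2 first.
- by rewrite z0.
(* The tangent at [l] is nonnegative to the right of [l]. *)
- apply: le_trans (lo 0%N isT); have [-> _ _] := xi_feasible.
  have /andP[xl xu] := xlu.
  have fl : 0 <= powf p l by exact: powR_ge0.
  have dl := dpowf_ge0 l p_gt1; nra.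
by rewrite hi andbT; apply/key.
Qed.

Lemma cone_apex x y : polyhedron cone_faces (x, y, 0) -> x = 0 /\ y = 0.
Proof.
move=> /coneP[lo hi]; rewrite !mulr0 => /le_anti x0 _.
move: hi; rewrite -x0 !mulr0 addr0 => y0.
have := lo 0%N isT; rewrite -x0 !mulr0 addr0 => y0'.
by split=> //; apply/le_anti; rewrite y0.
Qed.

Lemma convex_perspective :
  @convex_set R (R^o * R^o * R^o)%type (perspective_set l u p xi).
Proof.
move=> [[x1 y1] z1] [[x2 y2] z2] k; rewrite !inE.
move=> /perspectiveP[w1 z1_gt0] /perspectiveP[w2 z2_gt0].
have k0 : 0 <= k%:num by []; have k1 : k%:num <= 1 by [].
set w := (X in perspective_set _ _ _ _ X).
have -> : w = (k%:num * x1 + (1 - k%:num) * x2,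
    k%:num * y1 + (1 - k%:num) * y2, k%:num * z1 + (1 - k%:num) * z2) by [].
apply/perspectiveP; split.
  move=> c cP; have := w1 c cP; have := w2 c cP.
  move: c {cP} => [[[c1 c2] c3] c0] /=.
  set A := (X in 0 <= X); set B := (X in _ -> 0 <= X -> _) => h2 h1.
  have := addr_ge0 (mulr_ge0 k0 h1) (mulr_ge0 (_ : 0 <= 1 - k%:num) h2).
  rewrite subr_ge0 k1 => /(_ isT); rewrite /A /B; lra.
nra.
Qed.

(** The perspective set is convex and only lacks the apex [0] of the closed cone,
    which is approached along the edge through [(l, powf p l, 1)]. *)
Lemma UstarE : Ustar l u p xi = polyhedron cone_faces.
Proof.
rewrite /Ustar /convex_hull smallest_id; last exact: convex_perspective.
apply/seteqP; split.
  have /closure_id -> := @closed_polyhedron R cone_faces.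
  by apply: closure_subset => -[[x y] z] /perspectiveP[].
move=> [[x y] z] wP; have /coneP[_ _ _ /andP[+ _]] := wP.
rewrite le_eqVlt => /predU1P[z0|z0]; last first.
  by apply: subset_closure; apply/perspectiveP.
move: wP; rewrite -z0 => /cone_apex[-> ->] B B0.
pose f t : R * R * R := (t * l, t * powf p l, t).
have cf : {for 0, continuous (f : R -> R * R * R)}.
  have cM c : (t * c) @[t --> (0 : R)] --> 0 * c.
    by apply: cvgM; [exact: cvg_id|exact: cvg_cst].
  exact: (cvg_pair (cvg_pair (cM l) (cM (powf p l))) (@cvg_id _ (nbhs (0 : R)))).
have f0 : f 0 = (0, 0, 0) by rewrite /f !mul0r.
have Bf : \forall t \near 0^'+, B (f t).
  by apply: cvg_at_right_filter cf _ _; rewrite f0.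
near (0 : R)^'+ => t.
have t0 : 0 < t by [].
have t1 : t <= 1 by near: t; exact: nbhs_right_le.
exists (f t); split; last by near: t.
apply/perspectiveP; split=> //; apply/coneP; split.
- move=> i lin; have := envelope_le_secant (_ : l <= l <= u).
  rewrite lexx ltW// secant_l => /(_ isT) /envelope_leP /(_ i lin).
  rewrite -(ler_pM2l t0); apply: le_trans.
  by rewrite /tangent le_eqVlt; apply/orP; left; apply/eqP; ring.
- by rewrite le_eqVlt; apply/orP; left; apply/eqP; ring.
- by rewrite [t * l]mulrC lexx ler_pM2r// ltW.
- by rewrite ltW.
Unshelve. all: by end_near. Qed.

Lemma vol_Ustar : vol (Ustar l u p xi) =
  ((\int[@lebesgue_measure R]_(t in `[l, u])
      (secant t - envelope p xi t))%R / 3)%:E.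
Proof.
rewrite UstarE; apply: cone_volume.
- exact: ltW.
- exact: continuous_envelope.
- exact: continuous_secant.
- exact: envelope_le_secant.
- exact: measurable_polyhedron.
move=> x y z; have [->|zN0] := eqVneq z 0.
  split=> [/[dup] /coneP[_ _ xz z01] /cone_apex[-> ->]|[_]].
    by rewrite !mul0r !mulr0 !lexx ler01.
  rewrite !mul0r !mulr0 => /le_anti <- /le_anti <-.
  by apply/coneP; split=> [i _|||]; rewrite ?mulr0 ?addr0 ?lexx ?ler01.
have hiE : z * secant (x / z) = (powf p l - s * l) * z + s * x.
  by rewrite /secant; field.
rewrite hiE; split=> [/[dup] /coneP[_ _ _ z01] wP|[/andP[z0 z1] xlu]].
  have z_gt0 : 0 < z by rewrite lt_neqAle eq_sym zN0; have /andP[] := z01.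
  have /perspectiveP[/andP[lo hi] xlu _ _] :
    polyhedron cone_faces (x, y, z) /\ 0 < z by [].
  split=> //; rewrite hi -(pl_under_envelope l_ge0 p_gt1 n_gt0 xi_feasible) ?lo//.
  by have /andP[xl xu] := xlu; rewrite ler_pdivlMr// ler_pdivrMr// xl.
have z_gt0 : 0 < z by rewrite lt_neqAle eq_sym zN0.
move=> /andP[lo hi].
have /perspectiveP[] // : perspective_set l u p xi (x, y, z).
have /andP[xl xu] := xlu.
have xz : l <= x / z <= u by rewrite ler_pdivlMr// ler_pdivrMr// xl.
split; rewrite ?z_gt0//; first by rewrite pl_under_envelope ?lo.
apply: le_trans lo; apply: mulr_ge0 => //.
apply: le_trans (tangent_le_envelope _ _ _ (leq0n n)).
have [-> _ _] := xi_feasible; have /andP[xz1 _] := xz.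
by rewrite /tangent addr_ge0 ?powR_ge0// mulr_ge0 ?dpowf_ge0// subr_ge0.
Qed.

End Relaxation.

(** * Minimizers increase with the exponent *)

(** An unbalanced node could be moved so as to decrease the volume. *)
Lemma minimizer_balanced (R : realType) (l u p : R) n (xi : n.+1.-tuple R) :
  0 <= l -> l < u -> 1 < p -> is_minimizer l u p xi ->
  balanced p n (fun i => xi`_i).
Proof.
move=> l0 lu p1 [xif ximin] i iP; have /andP[i0 lin] := iP.
have n0 : (0 < n)%N by exact: ltn_trans i0 lin.
have tauP : tau l u p xi i = crossing p xi`_i.-1 xi`_i.
  by case: i i0 lin {iP} => // i _ /ltnW lin; exact: tauE.
rewrite /= -tauP -(tauE l u p xi lin).
apply/eqP; apply/negPn/negP => neq.
have [|fm] := envelope_improvement l0 p1 xif iP.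
  by apply: contra neq => /eqP <-; rewrite -[eqbRHS]mulr_natr divfK.
set xi' := move_node _ _ _ in fm *.
apply/negP; rewrite -leNgt.
have := ximin xi' fm; rewrite !vol_Ustar// lee_fin ler_pM2r//.
rewrite !RintegralB//; try by apply: continuous_integrable;
  (exact: continuous_envelope || exact: continuous_secant).
by rewrite lerD2l lerN2.
Qed.

Theorem theorem3p11 (R : realType) (l u : R) (n : nat)
  (l_ge0 : 0 <= l) (l_lt_u : l < u) (n_ge2 : (2 <= n)%N)
  (xi : R -> n.+1.-tuple R)
  (xi_min : forall p : R, 1 < p -> is_minimizer l u p (xi p)) :
  forall i : nat, (1 <= i <= n.-1)%N ->
  forall p q : R, 1 < p -> p < q -> (xi p)`_i < (xi q)`_i.
Proof.
move=> i iP p q p1 pq; have q1 := lt_trans p1 pq.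
have [[p0 pn pS] _] := xi_min p p1; have [[q0 qn qS] _] := xi_min q q1.
apply: (@balanced_lt _ p q n (fun i => (xi p)`_i) (fun i => (xi q)`_i)) => //.
- by rewrite p0.
- by rewrite p0.
- by rewrite pn.
- exact: minimizer_balanced (xi_min p p1).
- exact: minimizer_balanced (xi_min q q1).
- by case/andP: iP => -> ; case: n n_ge2 {xi xi_min p0 pn pS q0 qn qS}.
Qed.
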